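(* Let $\mathfrak{M}$ be a von Neumann algebra, let $A\in\mathfrak{M}$ be nonzero and positive, and let $\phi:\mathfrak{M}_A\to\mathbb{C}$ be a linear map. If $A$ is well-supported and $\phi(T)\in\sigma_A(T)$ for any $T\in\mathfrak{M}^A$, then $\phi$ is the restriction of a state $f$ of $\mathfrak{M}$ such that $\phi(A)\neq0$ and $\phi(TS)=\phi(T)\phi(S)$ for any $S,T\in\mathfrak{M}^A$.
   Context: $\mathfrak{M}$ acts on a complex Hilbert space $\mathcal{H}$ and contains the identity $I$. The positive element $A$ is called well-supported if $\sigma(A)\setminus\{0\}$ is closed, equivalently $\sigma(A)\subseteq\{0\}\cup[\alpha,\infty)$ for some $\alpha>0$. For $h\in\mathcal{H}$ put $\|h\|_A=\sqrt{\langle Ah,h\rangle}$, for $T\in\mathfrak{M}$ put $\|T\|_A=\sup\{\|Th\|_A:\|h\|_A=1\}$, and set $\mathfrak{M}^A=\{T\in\mathfrak{M}:\|T\|_A<\infty\}$. $\mathfrak{M}_A$ is the set of $T\in\mathfrak{M}$ admitting an $A$-adjoint, i.e. some $S\in\mathfrak{M}$ with $AS=T^*A$; when $A$ is well-supported, $\mathfrak{M}_A=\mathfrak{M}^A$. $T\in\mathfrak{M}^A$ is $A$-invertible in $\mathfrak{M}^A$ if there is $S\in\mathfrak{M}^A$ with $ATS=AST=A$; the $A$-spectrum is $\sigma_A(T)=\{\lambda\in\mathbb{C}:\lambda I-T\text{ is not }A\text{-invertible in }\mathfrak{M}^A\}$. A state of $\mathfrak{M}$ is a positive linear functional $f$ with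 $\|f\|=f(I)=1$. *)

(* Defs.v *)
From HB Require Import structures.
From mathcomp Require Export all_boot all_order all_algebra.
From mathcomp Require Export complex.
From mathcomp Require Export boolp classical_sets functions reals ereal.
From mathcomp Require Export topology normedtype.

Set Implicit Arguments.
Unset Strict Implicit.
Unset Printing Implicit Defensive.

Export Order.TTheory GRing.Theory Num.Theory.
Export numFieldNormedType.Exports.

#[global] Open Scope classical_set_scope.
#[global] Open Scope ring_scope.
#[global] Open Scope complex_scope.

(* Operators are plain functions H -> H, with the pointwise vector space
   structure, and operator algebras are sets of such functions; a map defined
   on such a set is a total function, constrained only on that set.  The norm
   of H takes its (real) values in R[i], hence the occurrences of Re below.   *)

Section Operators.
Context {R : realType} {H : completeNormedModType R[i]}.

(* The inner product is linear in its first argument. *)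
Definition is_hilbert (dot : {dot H for Num.conj}) : Prop :=
  forall h : H, `|h| ^+ 2 = dot h h.

Definition bounded_op : set (H -> H) := [set T | linear T /\ continuous T].

Definition linear_on (D : set (H -> H)) (f : (H -> H) -> R[i]) : Prop :=
  forall (a : R[i]) (T S : H -> H), D T -> D S -> f (a *: T + S) = a * f T + f S.

Definition op_norm (T : H -> H) : \bar R :=
  ereal_sup [set (complex.Re `|T h|)%:E | h in [set h | `|h| <= 1]].

Definition functional_norm (M : set (H -> H)) (f : (H -> H) -> R[i]) : \bar R :=
  ereal_sup [set (complex.Re `|f T|)%:E
            | T in [set T | M T /\ (op_norm T <= 1%:E)%E]].

Definition spectrum (M : set (H -> H)) (T : H -> H) : set R[i] :=
  [set l | ~ exists S, [/\ M S, (l *: idfun - T) \o S = idfun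
                         & S \o (l *: idfun - T) = idfun]].

(* R[i]^o is R[i] with its usual topology. *)
Definition well_supported (M : set (H -> H)) (A : H -> H) : Prop :=
  closed (spectrum M A `\ 0 : set R[i]^o).

Section InnerProduct.
Variable dot : {dot H for Num.conj}.

Definition is_adjoint (T T' : H -> H) : Prop :=
  forall x y, dot (T x) y = dot x (T' y).

Definition matrix_coef (T : H -> H) : {ptws (H * H) -> R[i]^o} :=
  fun p => dot (T p.1) p.2.

(* The weak operator topology: the coarsest one making all the maps
   T |-> <T x, y> continuous. *)
Definition wot : topologicalType := initial_topology matrix_coef.

Record von_neumann_algebra (M : set (H -> H)) : Prop := {
  vna_bounded : M `<=` bounded_op;
  vna_id : M idfun;
  vna_lin : forall (a : R[i]) T S, M T -> M S -> M (a *: T + S);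
  vna_comp : forall T S, M T -> M S -> M (T \o S);
  vna_adjoint : forall T, M T -> exists2 T', M T' & is_adjoint T T';
  vna_wot_closed : forall T, bounded_op T -> closure (M : set wot) T -> M T }.

Definition positive_op (T : H -> H) : Prop := forall h, 0 <= dot (T h) h.

Record state (M : set (H -> H)) (f : (H -> H) -> R[i]) : Prop := {
  state_linear : linear_on M f;
  state_positive : forall T, M T -> positive_op T -> 0 <= f T;
  state_norm : functional_norm M f = 1%:E;
  state_id : f idfun = 1 }.

Definition norm_A (A : H -> H) (h : H) : R :=
  Num.sqrt (complex.Re (dot (A h) h)).

Definition op_norm_A (A T : H -> H) : \bar R :=
  ereal_sup [set (norm_A A (T h))%:E | h in [set h | norm_A A h = 1]].

Definition A_bounded (M : set (H -> H)) (A : H -> H) : set (H -> H) :=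
  [set T | M T /\ (op_norm_A A T < +oo)%E].

Definition A_adjointable (M : set (H -> H)) (A : H -> H) : set (H -> H) :=
  [set T | M T /\
    exists S T', [/\ M S, is_adjoint T T' & A \o S = T' \o A]].

Definition A_invertible (M : set (H -> H)) (A T : H -> H) : Prop :=
  exists S, [/\ A_bounded M A S, A \o T \o S = A & A \o S \o T = A].

Definition A_spectrum (M : set (H -> H)) (A T : H -> H) : set R[i] :=
  [set l | ~ A_invertible M A (l *: idfun - T)].

End InnerProduct.
End Operators.

(* Main.v *)
Require Import Defs.
From HB Require Import structures.
From mathcomp Require Import ring lra.
From mathcomp Require Import sequences.

Set Implicit Arguments.
Unset Strict Implicit.
Unset Printing Implicit Defensive.

(** Let [P] be the projection onto the range of [A]. Since [A] is positive and
    well supported, it is bounded below on its range, so [P] lies in the algebra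
    [M], and so does an operator [B] inverting [A] on that range
    ([range_projection]). Hence [A X = A Y] means [P X = P Y], and all the
    notions relative to [A] are notions about the corner [P M P]: an operator
    [T] of [M] is [A]-bounded, equivalently has an [A]-adjoint, exactly when it
    preserves the kernel of [A], that is when [P T = P T P]; on such operators
    [T |-> P T P] is multiplicative, and the [A]-spectrum of [T] is the spectrum
    of [P T P] in the corner. In particular [phi T = 0] if [A T = 0], as the
    [A]-spectrum of [T] is then [{0}]; so [phi T = phi (P T P)]
    ([phi_compression]), and the state extending [phi] is [T |-> phi (P T P)].

    What remains is a statement about a linear functional on a C*-algebra whose
    value at each element lies in the spectrum of that element, for which the
    Gleason-Kahane-Zelazko theorem has an elementary proof. It is carried out on
    the operators commuting with [P], which avoids changing the unit. The
    spectrum of a self-adjoint [h] is real, and nonnegative if [h] is positive,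
    so [phi] is a positive functional with [phi 1 = 1]. The normal operator
    [h + i h ^ 2] has its spectrum on the parabola [{t + i t ^ 2}], so
    [phi h + i phi (h ^ 2)] lies on it and [phi (h ^ 2) = (phi h) ^ 2]
    ([phi_sqr]). By the Cauchy-Schwarz inequality for [phi] the operators
    [h - phi h] are then in the left kernel of [phi], which gives
    [phi (S h) = phi S * phi h], and multiplicativity follows by splitting an
    operator into its real and imaginary parts ([phi_comp_reduced]). Finally
    [phi A] is not [0] because [B] makes [A] invertible relative to itself.

    The spectral facts about [h] and [h + i h ^ 2] reduce to the invertibility
    in [M] of a normal operator that is bounded below ([normal_invertible]). That lemma and the
    construction of [P] both sum a geometric series pointwise
    ([geometric_series]); the sums stay in [M] because [M], being closed in the
    weak operator topology, is closed under pointwise limits of sequences.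
    Estimates are made with the real part of the inner product, which is a real
    inner product for which adjoints are still adjoints. *)

(** * The real inner product *)

Section InnerProduct.
Context {R : realType} {H : completeNormedModType R[i]}.
Context (dot : {dot H for Num.conj}).
Implicit Types (x y z : H) (a : R[i]) (r : R).

Lemma ReD a (b : R[i]) : complex.Re (a + b) = complex.Re a + complex.Re b.
Proof. by case: a b => ? ? [? ?]. Qed.

Lemma ReN a : complex.Re (- a) = - complex.Re a.
Proof. by case: a. Qed.

Lemma conjc_i : ('i%C : R[i])^*%C = - 'i%C.
Proof. by apply/eqP; rewrite eq_complex /= oppr0 !eqxx. Qed.

Lemma conjc_oppr_scale r a : (- (r%:C * a))^*%C = - (r%:C * a^*%C).
Proof.
by case: a => u v; apply/eqP; rewrite eq_complex /=; apply/andP; split;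
  apply/eqP; ring.
Qed.

Definition real_inner x y : R := complex.Re (dot x y).

Lemma dotC x y : dot x y = (dot y x)^*%C.
Proof. by rewrite (hermC dot x y) expr0 mul1r. Qed.

Lemma dotZr a x y : dot x (a *: y) = a^*%C * dot x y.
Proof. by rewrite (linearZr_LR dot). Qed.

Lemma dotZl a x y : dot (a *: x) y = a * dot x y.
Proof. by rewrite (linearZl_LR dot). Qed.

Lemma dotDl x y z : dot (x + y) z = dot x z + dot y z.
Proof. exact: (linearDl dot). Qed.

Lemma dotDr x y z : dot x (y + z) = dot x y + dot x z.
Proof. exact: (linearDr dot). Qed.

Lemma dotNl x y : dot (- x) y = - dot x y.
Proof. exact: (linearNl dot). Qed.

Lemma dotNr x y : dot x (- y) = - dot x y.
Proof. exact: (linearNr dot). Qed.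

Lemma ripC x y : real_inner x y = real_inner y x.
Proof. by rewrite /real_inner dotC; case: (dot y x). Qed.

Lemma ripDl x y z : real_inner (x + y) z = real_inner x z + real_inner y z.
Proof. by rewrite /real_inner (linearDl dot) ReD. Qed.

Lemma ripDr x y z : real_inner x (y + z) = real_inner x y + real_inner x z.
Proof. by rewrite ripC ripDl !(ripC _ x). Qed.

Lemma ripZl r x y : real_inner (r%:C *: x) y = r * real_inner x y.
Proof.
by rewrite /real_inner dotZl; case: (dot x y) => u v /=; rewrite mul0r subr0.
Qed.

Lemma ripZr r x y : real_inner x (r%:C *: y) = r * real_inner x y.
Proof. by rewrite ripC ripZl ripC. Qed.

Lemma ripNl x y : real_inner (- x) y = - real_inner x y.
Proof. by rewrite /real_inner (linearNl dot) ReN. Qed.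

Lemma ripNr x y : real_inner x (- y) = - real_inner x y.
Proof. by rewrite ripC ripNl ripC. Qed.

Lemma rip0l x : real_inner 0 x = 0.
Proof. by rewrite /real_inner (linear0l dot). Qed.

Lemma rip0r x : real_inner x 0 = 0.
Proof. by rewrite ripC rip0l. Qed.

Definition ripE := (ripDl, ripDr, ripNl, ripNr, ripZl, ripZr, rip0l, rip0r).

Lemma dot_rip x : dot x x = (real_inner x x)%:C.
Proof. by apply/esym/RRe_real/ger0_real/dnorm_ge0. Qed.

Lemma rip_ge0 x : 0 <= real_inner x x.
Proof. by have := dnorm_ge0 dot x; rewrite dot_rip lecR. Qed.

Lemma rip_eq0 x : real_inner x x = 0 -> x = 0.
Proof. by move=> x0; apply/eqP; rewrite -(dnorm_eq0 dot) dot_rip x0. Qed.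

Lemma rip_adjoint (T T' : H -> H) : is_adjoint dot T T' ->
  forall x y, real_inner (T x) y = real_inner x (T' y).
Proof. by move=> TT' x y; rewrite /real_inner TT'. Qed.

Lemma rip_CS x y : real_inner x y ^+ 2 <= real_inner x x * real_inner y y.
Proof.
have [y0|y0] := eqVneq (real_inner y y) 0.
  by rewrite (rip_eq0 y0) !rip0r expr0n mulr0.
have yy : 0 < real_inner y y by rewrite lt_neqAle eq_sym y0 rip_ge0.
have := rip_ge0 (x - (real_inner x y / real_inner y y)%:C *: y).
rewrite !ripE (ripC y x) => /(mulr_ge0 (ltW yy)).
set u := real_inner x x; set v := real_inner x y.
set w := real_inner y y in yy y0 *.
move=> le; rewrite -subr_ge0; apply: le_trans le _.
by rewrite le_eqVlt; apply/orP; left; apply/eqP; field.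
Qed.

(** Applying the real inequality to [x] and [dot x y *: y] captures the
   modulus of [dot x y], not just its real part. *)
Lemma dot_CS x y : `|dot x y| ^+ 2 <= (real_inner x x * real_inner y y)%:C.
Proof.
set z := dot x y.
have zE : dot x (z *: y) = `|z| ^+ 2.
  by rewrite dotZr -/z mulrC -normCK.
have zz : `|z| ^+ 2 = (complex.Re z ^+ 2 + complex.Im z ^+ 2)%:C.
  by rewrite -add_Re2_Im2.
have := rip_CS x (z *: y).
rewrite {1}/real_inner zE zz /=.
have -> : real_inner (z *: y) (z *: y) =
    (complex.Re z ^+ 2 + complex.Im z ^+ 2) * real_inner y y.
  rewrite {1}/real_inner dotZl dotZr mulrA.
  have -> : z * z^*%C = `|z| ^+ 2 by rewrite normCK.
  by rewrite zz dot_rip -rmorphM.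
set n := _ + _; rewrite lecR expr2.
have : 0 <= n by rewrite addr_ge0 ?sqr_ge0.
rewrite le_eqVlt => /orP[/eqP<- _|n0]; first by rewrite mulr_ge0 ?rip_ge0.
by rewrite mulrCA ler_pM2l.
Qed.

Context (hH : is_hilbert dot).

Lemma normE x : `|x| = (complex.Re `|x|)%:C.
Proof. by apply/esym/RRe_real/normr_real. Qed.

Lemma Re_norm_ge0 x : 0 <= complex.Re `|x|.
Proof. by rewrite -lecR -normE; exact: normr_ge0. Qed.

Lemma sqr_norm x : complex.Re `|x| ^+ 2 = real_inner x x.
Proof. by apply: complexI; rewrite rmorphXn /= -normE hH dot_rip. Qed.

Lemma norm_le (x y : H) k : 0 <= k ->
  real_inner x x <= k ^+ 2 * real_inner y y -> `|x| <= k%:C * `|y|.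
Proof.
move=> k0; rewrite -!sqr_norm -exprMn [`|x|]normE [`|y|]normE -rmorphM /= lecR.
by move=> le; rewrite -(ler_pXn2r (n := 2)) // nnegrE ?mulr_ge0 ?Re_norm_ge0.
Qed.

Lemma le_norm (x y : H) k : 0 <= k -> `|x| <= k%:C * `|y| ->
  real_inner x x <= k ^+ 2 * real_inner y y.
Proof.
move=> k0; rewrite [`|x|]normE [`|y|]normE -rmorphM /= lecR => le.
rewrite -!sqr_norm -exprMn ler_pXn2r // nnegrE ?mulr_ge0 ?Re_norm_ge0 //.
Qed.

Lemma continuous_dotl y : continuous (fun x => dot x y : R[i]^o).
Proof.
move=> x; apply/cvgrPdist_le => /= e e0.
have e0R : e = (complex.Re e)%:C by rewrite (RRe_real (gtr0_real e0)).
set k := complex.Re `|y|; have k0 : 0 <= k := Re_norm_ge0 y.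
have k1 : 0 < k + 1 by lra.
have d0 : 0 < (complex.Re e / (k + 1))%:C.
  by rewrite ltcR divr_gt0 // -ltcR -e0R.
near=> z.
rewrite -(linearBl dot).
have zx : `|x - z| <= (complex.Re e / (k + 1))%:C.
  by near: z; apply: cvgr_dist_le.
rewrite -(ler_pXn2r (n := 2)) ?nnegrE ?(ltW e0) //.
apply: le_trans (dot_CS _ _) _.
rewrite e0R -rmorphXn lecR -!sqr_norm -/k.
move: zx; rewrite normE lecR ler_pdivlMr //.
set w := complex.Re `|_| => zx.
rewrite -exprMn ler_pXn2r ?nnegrE ?mulr_ge0 ?Re_norm_ge0 //; last first.
  by rewrite -lecR -e0R ltW.
apply: le_trans zx; rewrite ler_wpM2l ?Re_norm_ge0 //; lra.
Unshelve. all: by end_near. Qed.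

(** * Bounded operators *)

Lemma eq_of_add_sub (u v x : H) : u = x + (u - v) -> v = x.
Proof. by move=> ux; apply: (addrI (u - v)); rewrite subrK [RHS]addrC. Qed.

Lemma linD (T : H -> H) : linear T -> forall x y, T (x + y) = T x + T y.
Proof. by move=> lT x y; have := lT 1 x y; rewrite !scale1r. Qed.

Lemma lin0 (T : H -> H) : linear T -> T 0 = 0.
Proof. by move=> lT; apply: (addrI (T 0)); rewrite -linD // !addr0. Qed.

Lemma linZ (T : H -> H) : linear T -> forall a x, T (a *: x) = a *: T x.
Proof. by move=> lT a x; have := lT a x 0; rewrite !addr0 lin0 // addr0. Qed.

Lemma linN (T : H -> H) : linear T -> forall x, T (- x) = - T x.
Proof. by move=> lT x; rewrite -scaleN1r linZ // scaleN1r. Qed.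

Lemma linB (T : H -> H) : linear T -> forall x y, T (x - y) = T x - T y.
Proof. by move=> lT x y; rewrite linD // linN. Qed.

Let pack_linear (f : H -> H) (lf : linear f) : {linear H -> H}
 := HB.pack f (GRing.isLinear.Build _ _ _ _ _ lf).

Lemma bounded_op_bound (T : H -> H) : bounded_op T ->
  exists2 K : R, 0 < K &
    forall x, real_inner (T x) (T x) <= K ^+ 2 * real_inner x x.
Proof.
move=> [lT cT].
have /(linear_bounded_continuous (pack_linear lT)) : continuous (pack_linear lT).
  exact: cT.
move=> /linear_boundedP /pinfty_ex_gt0 [r r0 Bf].
have rE : r = (complex.Re r)%:C by rewrite (RRe_real (gtr0_real r0)).
have r0' : 0 < complex.Re r by rewrite -ltcR -rE.
exists (complex.Re r) => // x; apply: le_norm; first exact: ltW.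
by rewrite -rE; exact: Bf.
Qed.

Lemma bound_bounded_op (T : H -> H) K : linear T -> 0 < K ->
  (forall x, real_inner (T x) (T x) <= K ^+ 2 * real_inner x x) -> bounded_op T.
Proof.
move=> lT K0 TK; split=> //.
suff : continuous (pack_linear lT) by [].
apply: bounded_linear_continuous.
apply/linear_boundedP; near=> r => x.
apply: le_trans (norm_le (ltW K0) (TK x)) _.
apply: ler_wpM2r => //.
near: r; apply: nbhs_pinfty_ge; rewrite complex_real.
Unshelve. all: by end_near. Qed.

Lemma rip_op_le (T : H -> H) K : 0 <= K ->
  (forall x, real_inner (T x) (T x) <= K ^+ 2 * real_inner x x) ->
  forall x, real_inner (T x) x <= K * real_inner x x.
Proof.
move=> K0 TK x.
have Kxx : 0 <= K * real_inner x x by rewrite mulr_ge0 ?rip_ge0.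
have [Tx0|/ltW Tx0] := leP (real_inner (T x) x) 0; first exact: le_trans Kxx.
rewrite -(ler_pXn2r (n := 2)) ?nnegrE //; apply: le_trans (rip_CS _ _) _.
by rewrite exprMn [X in _ <= _ * X]expr2 mulrA ler_wpM2r ?rip_ge0.
Qed.

Lemma op_norm_contraction (T : H -> H) : linear T -> (op_norm T <= 1%:E)%E ->
  forall x, real_inner (T x) (T x) <= real_inner x x.
Proof.
move=> lT T1 x; have [x0|x0] := eqVneq x 0.
  by rewrite x0 lin0 // lexx.
have s0 : 0 < complex.Re `|x| by rewrite -ltcR -normE normr_gt0.
pose h := (complex.Re `|x|)^-1%:C *: x.
have xh : x = (complex.Re `|x|)%:C *: h.
  by rewrite scalerA -rmorphM /= divff ?scale1r // gt_eqF.
have h1 : `|h| = 1.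
  rewrite normrZ [X in X * _]ger0_norm ?lecR ?invr_ge0 ?(ltW s0) //.
  by rewrite {2}[`|x|]normE -rmorphM /= mulVf // gt_eqF.
have Th : complex.Re `|T h| <= 1.
  rewrite -lee_fin; apply: le_trans T1; apply: ereal_sup_ubound; exists h => //=.
  by rewrite h1.
clearbody h; rewrite xh (linZ lT) !ripE !mulrA -!expr2.
rewrite ler_pM2l ?exprn_gt0 // -!sqr_norm h1.
by rewrite ler_pXn2r ?nnegrE ?Re_norm_ge0.
Qed.

End InnerProduct.

(** * Geometric series in a von Neumann algebra *)

Section GeometricSeries.
Context {R : realType} {H : completeNormedModType R[i]}.
Context (dot : {dot H for Num.conj}) (hH : is_hilbert dot).
Context (M : set (H -> H)) (hM : von_neumann_algebra dot M).
Implicit Types (x y z : H) (a : R[i]) (r : R) (S T X Y Z : H -> H).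

Local Notation rn x := (complex.Re `|x|).
Local Notation rip := (real_inner dot).

Lemma rn_triangle x y : rn (x + y) <= rn x + rn y.
Proof. by rewrite -lecR rmorphD /= -!normE; exact: ler_normD. Qed.

Lemma M_linear T : M T -> linear T.
Proof. by move=> /(vna_bounded hM)[]. Qed.

Lemma M_add S T : M S -> M T -> M (S + T).
Proof. by move=> MS MT; have := vna_lin hM 1 MS MT; rewrite scale1r. Qed.

Lemma M_scale a T : M T -> M (a *: T).
Proof.
move=> MT; have M0 : M 0.
  by have := vna_lin hM (-1) MT MT; rewrite scaleN1r addNr.
by have := vna_lin hM a MT M0; rewrite addr0.
Qed.

Lemma M_sub S T : M S -> M T -> M (S - T).
Proof.
by move=> MS MT; rewrite -scaleN1r; apply: M_add => //; apply: M_scale.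
Qed.

(** Pointwise convergence implies convergence of all matrix coefficients. *)
Lemma M_sot_closed (T_ : nat -> H -> H) T :
  (forall n, M (T_ n)) -> bounded_op T ->
  (forall x, T_ n x @[n --> \oo] --> T x) -> M T.
Proof.
move=> MT_ bT cvgT; apply: (vna_wot_closed hM) => // B.
rewrite nbhsE => -[_ [[V oV <-] TV] VB].
have : {ptws, (fun n => matrix_coef dot (T_ n)) @ \oo --> matrix_coef dot T}.
  apply/pointwise_cvgP => -[x y].
  have cd := continuous_dotl hH (y := y) (x := T x).
  have C : (fun n => dot (T_ n x) y : R[i]^o) @ \oo --> (dot (T x) y : R[i]^o).
    exact: (@cvg_comp _ _ _ (fun n => T_ n x) (fun v => dot v y : R[i]^o)
      _ _ _ (cvgT x) cd).
  exact: C.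
move=> /(_ V) cvV.
have /cvV[N _ NV] : nbhs (matrix_coef dot T) V by apply: open_nbhs_nbhs.
by exists (T_ N); split; [exact: MT_|apply: VB; apply: (NV N) => /=].
Qed.

(** The sum of the series of the operators [X ^ k Z], which converges because
    [X] contracts the range of [Z]. Taking [Z] to be the identity gives the
    Neumann series; smaller [Z] allow [X] to have fixed points. *)
Lemma geometric_series X Z q : M X -> M Z -> 0 <= q -> q < 1 ->
  (forall x, X (Z x) = Z (X x)) -> (forall x, rn (X (Z x)) <= q * rn (Z x)) ->
  exists S, [/\ M S, forall x, S x = Z x + X (S x), forall x, S x = Z x + S (X x)
             & forall x, (1 - q) * rn (S x) <= rn (Z x)].
Proof.
move=> MX MZ q0 q1 XZ Xq.
have [lX cX] := vna_bounded hM MX; have lZ := M_linear MZ.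
pose u k x := iter k X (Z x).
have uS k x : u k.+1 x = X (u k x) by [].
have uZ k x : u k x = Z (iter k X x).
  by elim: k x => [//|k IH] x; rewrite uS IH XZ.
have Mu k : M (u k).
  elim: k => [|k IH]; first exact: MZ.
  exact: (vna_comp hM MX IH).
have u_le k x : rn (u k x) <= q ^+ k * rn (Z x).
  elim: k => [|k IH]; first by rewrite expr0 mul1r.
  rewrite uS uZ; apply: le_trans (Xq _) _.
  by rewrite -uZ exprS -mulrA ler_wpM2l.
pose T_ n : H -> H := iteri n (fun k T => T + u k) 0.
have MT (n : nat) : M (T_ n).
  elim: n => [|n IH /=]; last exact: M_add.
  by have := M_scale 0 MZ; rewrite scale0r.
have TX n x : T_ n.+1 x = Z x + X (T_ n x).
  elim: n => [|n IH]; first by rewrite /= lin0 // addr0 /= add0r.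
  by rewrite -[LHS]/(T_ n.+1 x + X (u n x)) {1}IH -addrA -(linD lX).
have TX' n x : T_ n.+1 x = Z x + T_ n (X x).
  elim: n => [|n IH]; first by rewrite /= addr0 add0r.
  rewrite -[LHS]/(T_ n.+1 x + X (u n x)) IH -addrA; congr (_ + _).
  rewrite -[RHS]/(T_ n (X x) + u n (X x)); congr (_ + _).
  by rewrite !uZ XZ -iterSr.
have iq : 0 < 1 - q by rewrite subr_gt0.
pose b x := rn (Z x) / (1 - q).
have b0 x : 0 <= b x by rewrite divr_ge0 ?Re_norm_ge0 // ltW.
have bq x : rn (Z x) = b x * (1 - q) by rewrite divfK // gt_eqF.
have T_dist n j x : rn (T_ (n + j)%N x - T_ n x) <= b x * (q ^+ n - q ^+ (n + j)).
  elim: j => [|j IH]; first by rewrite addn0 !subrr normr0 mulr0.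
  rewrite addnS /= -[(_ + _) x]/(T_ (n + j)%N x + u (n + j)%N x) addrAC.
  apply: le_trans (rn_triangle _ _) _.
  apply: le_trans (lerD IH (u_le _ _)) _.
  by rewrite bq exprS le_eqVlt; apply/orP; left; apply/eqP; ring.
have T_dist' n j x : rn (T_ (n + j)%N x - T_ n x) <= b x * q ^+ n.
  apply: le_trans (T_dist n j x) _; apply: ler_wpM2l => //.
  by rewrite gerBl exprn_ge0.
have qn : (fun n => q ^+ n) @ \oo --> (0 : R).
  apply: cvg_expr; by rewrite ger0_norm.
have T_cvg x : cvg (T_ n x @[n --> \oo]).
  apply/cauchy_cvgP/cauchy_exP => e e0.
  have eE : e = (complex.Re e)%:C by rewrite (RRe_real (gtr0_real e0)).
  have e0' : 0 < complex.Re e by rewrite -ltcR -eE.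
  have b1 : 0 < b x + 1 by rewrite ltr_wpDl.
  have [N _ /(_ N (leqnn N)) /= Nq] :
      \forall n \near \oo, `|0 - q ^+ n| < complex.Re e / (b x + 1).
    by apply: cvgr_dist_lt => //; rewrite divr_gt0.
  exists (T_ N x); exists N => // m /= Nm.
  rewrite -ball_normE /ball_ /= distrC normE eE ltcR.
  rewrite -(subnKC Nm); apply: le_lt_trans (T_dist' _ _ _) _.
  move: Nq; rewrite sub0r normrN ger0_norm ?exprn_ge0 // ltr_pdivlMr // => Nq.
  apply: le_lt_trans Nq; rewrite mulrC ler_wpM2l ?exprn_ge0 //; lra.
pose S x := lim (T_ n x @[n --> \oo]).
have TS x : T_ n x @[n --> \oo] --> S x by exact: T_cvg.
have uniq x (v w : H) : T_ n x @[n --> \oo] --> v -> v = S x.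
  by move=> Tv; apply/esym/cvg_lim => //; exact: norm_hausdorff.
have TS1 x : T_ n.+1 x @[n --> \oo] --> S x.
  by rewrite (cvg_shiftS (fun n => T_ n x)); exact: TS.
have SX x : S x = Z x + X (S x).
  apply: (cvg_unique _ (TS1 x)); first exact: norm_hausdorff.
  rewrite (_ : (fun n => _) = (fun n => Z x + X (T_ n x))); last first.
    by apply/funext => n; exact: TX.
  apply: cvgD; first exact: cvg_cst.
  exact: (cvg_comp _ _ (TS x) (cX _)).
have SX' x : S x = Z x + S (X x).
  apply: (cvg_unique _ (TS1 x)); first exact: norm_hausdorff.
  rewrite (_ : (fun n => _) = (fun n => Z x + T_ n (X x))); last first.
    by apply/funext => n; exact: TX'.
  apply: cvgD; [exact: cvg_cst|exact: TS].
have lS : linear S.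
  move=> a x y; apply/esym/uniq => //.
  rewrite (_ : (fun n => _) = (fun n => a *: T_ n x + T_ n y)); last first.
    by apply/funext => n; exact: (M_linear (MT n)).
  apply: cvgD; [apply: cvgZr; exact: TS|exact: TS].
have Sb x : (1 - q) * rn (S x) <= rn (Z x).
  rewrite mulrC -ler_pdivlMr // -/(b x).
  apply/ler_addgt0Pr => e e0.
  have [N _ /(_ N (leqnn N)) /= Ne] :
      \forall n \near \oo, `|S x - T_ n x| < e%:C.
    by apply: cvgr_dist_lt; [exact: TS|rewrite ltcR].
  rewrite -(subrK (T_ N x) (S x)) addrC; apply: le_trans (rn_triangle _ _) _.
  apply: lerD; last by move: Ne; rewrite normE ltcR => /ltW.
  have := T_dist' 0%N N x; rewrite add0n expr0 mulr1.
  by rewrite [T_ 0%N x](_ : _ = 0) // subr0.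
exists S; split=> //.
apply: (M_sot_closed MT) => //.
have [K K0 ZK] := bounded_op_bound hH (vna_bounded hM MZ).
apply: (bound_bounded_op hH lS (K := K / (1 - q))); first by rewrite divr_gt0.
move=> x.
have := Sb x; have := ZK x; rewrite -!(sqr_norm hH) expr_div_n.
have := Re_norm_ge0 (S x).
move=> s0 z1 z2.
rewrite mulrAC ler_pdivlMr ?exprn_gt0 //; apply: le_trans z1.
by rewrite mulrC -exprMn ler_pXn2r // nnegrE ?mulr_ge0 ?Re_norm_ge0 // ltW.
Qed.

End GeometricSeries.

(** * Adjoints, positive operators and normal operators *)

Section NormalOperators.
Context {R : realType} {H : completeNormedModType R[i]}.
Context (dot : {dot H for Num.conj}) (hH : is_hilbert dot).
Context (M : set (H -> H)) (hM : von_neumann_algebra dot M).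
Implicit Types (x y z : H) (a : R[i]) (r : R) (S T X Y Z : H -> H).

Local Notation rn x := (complex.Re `|x|).
Local Notation rip := (real_inner dot).

Lemma adjoint_sym S T : is_adjoint dot S T -> is_adjoint dot T S.
Proof. by move=> ST x y; rewrite dotC -ST -dotC. Qed.

Lemma adjoint_comp S S' T T' : is_adjoint dot S S' -> is_adjoint dot T T' ->
  is_adjoint dot (S \o T) (T' \o S').
Proof. by move=> SS' TT' x y; rewrite -[(S \o T) x]/(S (T x)) SS' TT'. Qed.

Lemma adjoint_add S S' T T' : is_adjoint dot S S' -> is_adjoint dot T T' ->
  is_adjoint dot (S + T) (S' + T').
Proof.
move=> SS' TT' x y.
by rewrite -[(S + T) x]/(S x + T x) dotDl dotDr SS' TT'.
Qed.

Lemma adjoint_id : is_adjoint dot idfun idfun.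
Proof. by []. Qed.

Lemma adjoint_inj T T' : is_adjoint dot T T' -> forall T'', is_adjoint dot T T'' ->
  T' = T''.
Proof.
move=> TT' T'' TT''; apply/funext => y; apply/eqP; rewrite -subr_eq0; apply/eqP.
set d := _ - _; apply: (rip_eq0 (dot := dot)).
by rewrite /real_inner {2}/d dotDr dotNr -TT' -TT'' subrr.
Qed.

Lemma positive_selfadjoint T : linear T -> positive_op dot T -> is_adjoint dot T T.
Proof.
move=> lT pT.
have ImD u v : complex.Im (u + v : R[i]) = complex.Im u + complex.Im v.
  by case: u v => ? ? [].
have im x : complex.Im (dot (T x) x) = 0.
  by have := pT x; rewrite lecE => /andP[/eqP].
have sum_im x y : complex.Im (dot (T x) y) + complex.Im (dot (T y) x) = 0.
  have := im (x + y); rewrite linD // !dotDl !dotDr !ImD !im; lra.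
move=> x y; rewrite (dotC _ x); have := sum_im x y.
(* Testing with ['i *: y] too turns imaginary parts into real ones. *)
have := sum_im x ('i%C *: y); rewrite (linZ lT) dotZl dotZr.
case: (dot (T x) y) (dot (T y) x) => [p1 p2] [q1 q2] /= e1 e2.
by apply/eqP; rewrite eq_complex /=; apply/andP; split; apply/eqP; lra.
Qed.

Lemma selfadjoint_rip T : is_adjoint dot T T ->
  forall x y, rip (T x) y = rip (T y) x.
Proof. by move=> TT x y; rewrite (rip_adjoint TT) ripC. Qed.

Lemma adjoint_real_part T T' : is_adjoint dot T T' ->
  is_adjoint dot (T + T') (T + T').
Proof.
move=> TT'; have T'T := adjoint_sym TT'.
by rewrite {2}[T + T']addrC; apply: adjoint_add.
Qed.

Lemma adjoint_imaginary_part T T' : is_adjoint dot T T' ->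
  is_adjoint dot ('i%C *: (T - T')) ('i%C *: (T - T')).
Proof.
move=> TT' x y; have T'T := adjoint_sym TT'.
have E z : ('i%C *: (T - T')) z = 'i%C *: (T z - T' z) by [].
rewrite !E dotZl dotZr dotDl dotNl dotDr dotNr TT' T'T.
by rewrite conjc_i mulNr -mulrN opprB.
Qed.

Lemma selfadjoint_rip_i T : is_adjoint dot T T -> forall x, rip (T x) ('i%C *: x) = 0.
Proof.
move=> TT x; rewrite /real_inner dotZr.
have : complex.Im (dot (T x) x) = 0.
  by have := dotC dot x (T x); rewrite TT; case: (dot x (T x)) => u v [] /=; lra.
by case: (dot (T x) x) => u v /= ->; ring.
Qed.

Lemma rip_i x : rip ('i%C *: x) ('i%C *: x) = rip x x.
Proof.
rewrite /real_inner dotZl dotZr mulrA.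
have -> : 'i%C * ('i%C)^*%C = 1 :> R[i].
  by apply/eqP; rewrite eq_complex /=; apply/andP; split; apply/eqP; ring.
by rewrite mul1r.
Qed.

(** This is [T ^ 2 <= K T] for a positive operator with [|T| <= K], obtained
    by testing positivity against [x - T x / K]. *)
Lemma positive_sqr_le T : M T -> is_adjoint dot T T ->
  (forall x, 0 <= rip (T x) x) ->
  exists2 K, 0 < K & forall x, rip (T x) (T x) <= K * rip (T x) x.
Proof.
move=> MT TT T0; have [K K0 TK] := bounded_op_bound hH (vna_bounded hM MT).
exists K => // x.
have lT := M_linear hM MT.
have TyK := rip_op_le (ltW K0) TK.
have := T0 (x - K^-1%:C *: T x).
rewrite linB // (linZ lT) !ripE (selfadjoint_rip TT (T x) x).
set p := rip _ x; set q := rip (T x) (T x); set s := rip (T (T x)) (T x).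
have sq : s <= K * q := TyK (T x).
move=> h0.
have h : 0 <= p - 2 * (K^-1 * q) + K^-1 * (K^-1 * s).
  by apply: le_trans h0 _; rewrite le_eqVlt; apply/orP; left; apply/eqP; ring.
have : K^-1 * (K^-1 * s) <= K^-1 * q.
  by rewrite ler_wpM2l ?invr_ge0 ?(ltW K0) // mulrC ler_pdivrMr // mulrC.
move=> h1; rewrite -ler_pdivrMl //; lra.
Qed.

(** The inverse is [(Y^* Y)^-1 Y^*], where [Y^* Y >= e] makes [1 - s Y^* Y] a
    strict contraction for small [s]. *)
Lemma normal_invertible Y Y' e : M Y -> M Y' -> is_adjoint dot Y Y' ->
  (forall x, Y (Y' x) = Y' (Y x)) -> 0 < e ->
  (forall x, e * rip x x <= rip (Y x) (Y x)) ->
  exists W, [/\ M W, forall x, Y (W x) = x & forall x, W (Y x) = x].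
Proof.
move=> MY MY' YY' YC e0 Ye.
have [K0 K00 YK0] := bounded_op_bound hH (vna_bounded hM MY').
have lY := M_linear hM MY; have lY' := M_linear hM MY'.
(* The bound is enlarged to have [e <= K ^+ 2], so that [0 <= q] for the
   contraction ratio [q]. *)
pose K := K0 + 1 + e.
have K_gt0 : 0 < K by rewrite /K; lra.
have YK x : rip (Y' x) (Y' x) <= K ^+ 2 * rip x x.
  apply: le_trans (YK0 x) _; rewrite ler_wpM2r ?rip_ge0 //.
  rewrite ler_pXn2r ?nnegrE ?(ltW K_gt0) ?(ltW K00) //.
  by rewrite /K; lra.
have eK : e <= K ^+ 2 by rewrite /K; nra.
pose s := (K ^+ 2)^-1.
have K2 : 0 < K ^+ 2 by rewrite exprn_gt0.
have s0 : 0 < s by rewrite invr_gt0.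
have sK : s * K ^+ 2 = 1 by rewrite mulVf // gt_eqF.
pose D := s%:C *: (Y' \o Y).
have DE x : D x = s%:C *: Y' (Y x) by [].
have MD : M D by apply: (M_scale hM); exact: (vna_comp hM).
pose X := idfun - D.
have XE x : X x = x - D x by [].
have MX : M X by apply: (M_sub hM) => //; exact: (vna_id hM).
have se : s * e <= 1 by rewrite -sK ler_pM2l.
pose q := 1 - s * e / 2.
have se0 : 0 < s * e by rewrite mulr_gt0.
have q0 : 0 <= q by rewrite /q; lra.
have q1 : q < 1 by rewrite /q; lra.
have Xq x : rn (X x) <= q * rn x.
  rewrite -(ler_pXn2r (n := 2)) ?nnegrE ?mulr_ge0 ?Re_norm_ge0 //.
  rewrite exprMn !(sqr_norm hH) XE DE !ripE.
  have xY : rip x (Y' (Y x)) = rip (Y x) (Y x) by rewrite (rip_adjoint YY').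
  rewrite (ripC _ (Y' (Y x)) x) xY.
  have := YK (Y x); have := Ye x; have := rip_ge0 dot x.
  set p := rip x x; set t := rip (Y x) (Y x); set w := rip _ _ => p0 ep wK.
  have sw : s * w <= t.
    have := ler_wpM2l (ltW s0) wK; rewrite mulrA sK; lra.
  have : s * (s * w) <= s * t by rewrite ler_pM2l.
  have : s * (e * p) <= s * t by rewrite ler_pM2l.
  have -> : q ^+ 2 * p = p - s * (e * p) + (s * e / 2) ^+ 2 * p.
    by rewrite /q; field.
  have : 0 <= (s * e / 2) ^+ 2 * p by rewrite mulr_ge0 // sqr_ge0.
  lra.
have [S [MS S1 S2 _]] := geometric_series hH hM MX (vna_id hM) q0 q1
  (fun x => erefl (X x)) Xq.
have lS := M_linear hM MS.
have DS x : D (S x) = x.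
  by apply: (eq_of_add_sub (u := S x)); exact: (S1 x).
have SD x : S (D x) = x.
  by apply: (eq_of_add_sub (u := S x)); rewrite -(linB lS) -XE; exact: S2.
have YD x : Y (D x) = D (Y x) by rewrite !DE linZ // YC.
have SY x : S (Y x) = Y (S x) by rewrite -{1}(DS x) YD SD.
exists (s%:C *: (S \o Y')); split.
- apply: (M_scale hM); exact: (vna_comp hM).
- move=> x; rewrite -[(_ *: _) x]/(s%:C *: S (Y' x)) linZ // -SY YC.
  by rewrite -(linZ lS) -DE SD.
- move=> x; rewrite -[(_ *: _) _]/(s%:C *: S (Y' (Y x))).
  by rewrite -(linZ lS) -DE SD.
Qed.

(** With [r = sqrt (c ^ 2 + m)] one has
    [A ^ 2 - 2 c A - m = (A - (c - r)) (A - (c + r))], and [c - r], [c + r] lie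
    in the spectral gap when [- c ^ 2 <= m < 0], so the left side is invertible
    for these [m]. But it cannot be when [m] is the largest lower bound of
    [A ^ 2 - 2 c A]: a positive invertible operator is bounded below by a
    positive constant. As [A ^ 2 - 2 c A >= - c ^ 2], this leaves only
    [A ^ 2 - 2 c A >= 0]. *)
Lemma spectral_gap_sqr_ge A c : 0 < c -> M A -> is_adjoint dot A A ->
  (forall r, 0 < r -> r < 2 * c -> ~ spectrum M A r%:C) ->
  forall x, 2 * c * rip (A x) x <= rip (A x) (A x).
Proof.
move=> c0 MA AA gap.
have lA := M_linear hM MA.
pose b x := rip (A x) (A x) - 2 * c * rip (A x) x.
pose E := [set m : R | m <= 0 /\ forall x, m * rip x x <= b x].
have Ec : E (- c ^+ 2).
  split=> [|x]; first by rewrite oppr_le0 sqr_ge0.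
  have := rip_ge0 dot (A x - c%:C *: x).
  rewrite !ripE (ripC _ x) /b; set p := rip x x; set q := rip (A x) x.
  set t := rip (A x) (A x); move=> h; rewrite -subr_ge0.
  by apply: le_trans h _; rewrite le_eqVlt; apply/orP; left; apply/eqP; ring.
have Esup : has_sup E.
  by split; [exists (- c ^+ 2)|exists 0 => m []].
pose m := sup E.
have Em : E m.
  split; first by apply: ge_sup; [exists (- c ^+ 2)|move=> ? []].
  move=> x; have := rip_ge0 dot x; rewrite le_eqVlt => /orP[/eqP x0|x0].
    by rewrite -x0 mulr0; have [_ /(_ x)] := Ec; rewrite -x0 mulr0.
  rewrite -ler_pdivlMr //; apply: ge_sup; first by exists (- c ^+ 2).
  by move=> n [_ /(_ x)]; rewrite ler_pdivlMr.
have mc : - c ^+ 2 <= m by apply: sup_upper_bound.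
case: (Em) => m_le0 mb.
move: m_le0; rewrite le_eqVlt => /orP[/eqP m0 x|m0].
  by have := mb x; rewrite m0 mul0r /b subr_ge0.
exfalso.
pose r := Num.sqrt (c ^+ 2 + m).
have r2 : r ^+ 2 = c ^+ 2 + m by rewrite sqr_sqrtr // -lerBlDl sub0r.
have r0 : 0 <= r by exact: sqrtr_ge0.
have rc : r < c.
  rewrite -(ltr_pXn2r (n := 2)) ?nnegrE ?(ltW c0) // r2; lra.
have inv l : 0 < l -> l < 2 * c ->
    exists2 W, M W & forall x, W (l%:C *: x - A x) = x.
  move=> l0 lc; have /contrapT[W [MW _ WA]] := gap _ l0 lc.
  by exists W => // x; exact: (congr1 (@^~ x) WA).
have [W1 MW1 W1A] : exists2 W, M W & forall x, W ((c - r)%:C *: x - A x) = x.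
  by apply: inv; lra.
have [W2 MW2 W2A] : exists2 W, M W & forall x, W ((c + r)%:C *: x - A x) = x.
  by apply: inv; lra.
pose L l := l%:C *: idfun - A.
have LE l x : L l x = l%:C *: x - A x by [].
have ML l : M (L l).
  by apply: (M_sub hM) => //; apply: (M_scale hM); exact: (vna_id hM).
pose C := L (c - r) \o L (c + r).
have MC : M C by exact: (vna_comp hM).
have CE x : C x = A (A x) - (2 * c)%:C *: A x + (- m)%:C *: x.
  rewrite -[C x]/(L (c - r) (L (c + r) x)) !LE (linB lA) (linZ lA).
  rewrite scalerBr scalerA -rmorphM /=.
  have -> : (c - r) * (c + r) = - m by rewrite -subr_sqr r2; ring.
  have -> : (2 * c)%:C = (c - r)%:C + (c + r)%:C.
    by rewrite -rmorphD; congr (_%:C); ring.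
  rewrite scalerDl opprB addrC opprD -!addrA; congr (_ + _).
  by rewrite [RHS]addrC !addrA [RHS]addrAC addrAC.
have Cb x : rip (C x) x = b x - m * rip x x.
  by rewrite CE !ripE (selfadjoint_rip AA (A x)) /b; ring.
have CC : is_adjoint dot C C.
  move=> x y; rewrite !CE !dotDl !dotDr !dotNl !dotNr !dotZl !dotZr !conjc_real.
  by rewrite !AA.
have C0 x : 0 <= rip (C x) x by rewrite Cb subr_ge0.
have [K K0 CK] := positive_sqr_le MC CC C0.
have [N N0 WN] := bounded_op_bound hH (vna_bounded hM (vna_comp hM MW2 MW1)).
have Cx x : rip x x <= N ^+ 2 * K * rip (C x) x.
  have {1 2}<- : W2 (W1 (C x)) = x.
    by rewrite -[C x]/(L (c - r) (L (c + r) x)) LE W1A LE W2A.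
  apply: le_trans (WN (C x)) _.
  by rewrite -mulrA ler_wpM2l ?sqr_ge0.
have NK : 0 < N ^+ 2 * K by rewrite mulr_gt0 ?exprn_gt0.
(* [b - m] is bounded below by [1 / (N ^ 2 K)], so [m] can be increased. *)
pose d := Num.min (- m) (N ^+ 2 * K)^-1.
have d0 : 0 < d by rewrite lt_min oppr_gt0 m0 invr_gt0.
have Emd : E (m + d).
  split=> [|x]; first by rewrite -lerBrDl sub0r ge_min lexx.
  have h : d * rip x x <= rip (C x) x.
    apply: (@le_trans _ _ ((N ^+ 2 * K)^-1 * rip x x)).
      by rewrite ler_wpM2r ?rip_ge0 // ge_min lexx orbT.
    by rewrite ler_pdivrMl.
  by move: h; rewrite Cb; lra.
have := sup_upper_bound Esup Emd; rewrite -/m; lra.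
Qed.

End NormalOperators.

(** * The range projection of a well-supported operator *)

Section RangeProjection.
Context {R : realType} {H : completeNormedModType R[i]}.
Context (dot : {dot H for Num.conj}) (hH : is_hilbert dot).
Context (M : set (H -> H)) (hM : von_neumann_algebra dot M).
Implicit Types (x y z : H) (a : R[i]) (r : R) (S T X Y Z : H -> H).

Local Notation rn x := (complex.Re `|x|).
Local Notation rip := (real_inner dot).

(** Removing [0] from the spectrum leaves a closed set that misses [0], hence a
    whole neighbourhood of [0]. *)
Lemma well_supported_gap A : well_supported M A ->
  exists2 c : R, 0 < c & forall r, 0 < r -> r < 2 * c -> ~ spectrum M A r%:C.
Proof.
move=> /closed_openC oU.
have : nbhs (0 : R[i]^o) (~` (spectrum M A `\ 0)).
  by apply: open_nbhs_nbhs; split=> // -[_ /(_ erefl)].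
move=> /nbhs_ballP[e /= e0 eU].
have eE : e = (complex.Re e)%:C by rewrite (RRe_real (gtr0_real e0)).
exists (complex.Re e / 2) => [|r r0 re sr].
  by rewrite divr_gt0 // -ltcR -eE.
have := eU r%:C; apply=> //.
  rewrite -ball_normE /ball_ /= sub0r normrN eE normc_def /= expr0n addr0.
  by rewrite sqrtr_sqr gtr0_norm // ltcR; lra.
by split=> // /eqP; rewrite eq_complex /= gt_eqF.
Qed.

(** Positivity of [A] is tested on [x - A x / k]. *)
Lemma bounded_below_on_range A k : M A -> is_adjoint dot A A ->
  (forall x, 0 <= rip (A x) x) -> 0 < k ->
  (forall x, k * rip (A x) x <= rip (A x) (A x)) ->
  forall x, k * rip (A x) (A x) <= rip (A (A x)) (A x).
Proof.
move=> MA AA A0 k0 Ak x; have lA := M_linear hM MA.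
have := A0 (x - k^-1%:C *: A x).
rewrite (linB lA) (linZ lA) !ripE (selfadjoint_rip AA (A x) x).
have := Ak x.
set p := rip _ x; set q := rip (A x) (A x); set s := rip (A (A x)) (A x).
rewrite -ler_pdivlMl // => pq h0.
have h : 0 <= p - 2 * (k^-1 * q) + k^-1 * (k^-1 * s).
  by apply: le_trans h0 _; rewrite le_eqVlt; apply/orP; left; apply/eqP; ring.
have : k^-1 * q <= k^-1 * (k^-1 * s) by lra.
by rewrite ler_pM2l ?invr_gt0 // ler_pdivlMl.
Qed.

(** On the range of [A], [B] is the inverse of [A]; on the kernel of [A] it may be
    any operator of the kernel into itself. *)
Record range_inverse (A P B : H -> H) : Prop := {
  ri_MP : M P;
  ri_MB : M B;
  ri_adj : is_adjoint dot P P;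
  ri_idem : forall x, P (P x) = P x;
  ri_AP : forall x, A (P x) = A x;
  ri_PA : forall x, P (A x) = A x;
  ri_AB : forall x, A (B x) = P x;
  ri_BA : forall x, B (A x) = P x;
  ri_PB : forall x, P (B x) = B (P x) }.

(** On the range of [A] the operator [1 - t A] is a strict contraction for small
    [t], so the series [P = t \sum_k (1 - t A) ^ k A] converges in [M]. That [P]
    is an orthogonal projection follows from [A P = A = P A] and
    [|P x| <= C |A x|] alone: by the latter [P] kills the range of [1 - P] and
    that of [1 - P^*], so [P = P ^ 2 = P P^*]. Finally [A + (1 - P)] is
    self-adjoint and bounded below, and [B] is its inverse. *)
Lemma range_projection A : M A -> is_adjoint dot A A ->
  (forall x, 0 <= rip (A x) x) -> well_supported M A ->
  exists P B, range_inverse A P B.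
Proof.
move=> MA AA A0 ws; have lA := M_linear hM MA.
have [c c0 gap] := well_supported_gap ws.
have Ac := spectral_gap_sqr_ge hH hM c0 MA AA gap.
pose k := 2 * c; have k0 : 0 < k by rewrite /k; lra.
have Ar := bounded_below_on_range MA AA A0 k0 Ac.
have [K0 K00 AK0] := positive_sqr_le hH hM MA AA A0.
(* The bound is enlarged to have [k <= K], so that [0 <= q] for the contraction
   ratio [q]. *)
pose K := K0 + k.
have K_gt0 : 0 < K by rewrite /K; lra.
have AK x : rip (A x) (A x) <= K * rip (A x) x.
  by apply: le_trans (AK0 x) _; rewrite ler_wpM2r // /K; lra.
pose t := K^-1; have t0 : 0 < t by rewrite invr_gt0.
have tK : t * K = 1 by rewrite mulVf // gt_eqF.
have tk : t * k <= 1 by rewrite -tK ler_pM2l // /K; lra.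
have tk0 : 0 < t * k by rewrite mulr_gt0.
pose q := 1 - t * k / 2.
have q0 : 0 <= q by rewrite /q; lra.
have q1 : q < 1 by rewrite /q; lra.
pose X := idfun - t%:C *: A.
have XE x : X x = x - t%:C *: A x by [].
have MX : M X.
  by apply: (M_sub hM); [exact: (vna_id hM)|exact: (M_scale hM)].
have XA x : X (A x) = A (X x) by rewrite !XE (linB lA) (linZ lA).
have Xq x : rn (X (A x)) <= q * rn (A x).
  rewrite -(ler_pXn2r (n := 2)) ?nnegrE ?mulr_ge0 ?Re_norm_ge0 //.
  rewrite exprMn !(sqr_norm hH) XE !ripE (ripC _ (A x)).
  have := Ar x; have := AK (A x); have := rip_ge0 dot (A x).
  set p := rip (A x) (A x); set s := rip (A (A x)) (A x); set w := rip _ _.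
  move=> p0 wK kp.
  have tw : t * w <= s by rewrite -(ler_pM2l K_gt0) mulrA (mulrC K) tK mul1r.
  have : t * (t * w) <= t * s by rewrite ler_pM2l.
  have : t * (k * p) <= t * s by rewrite ler_pM2l.
  have -> : q ^+ 2 * p = p - t * (k * p) + (t * k / 2) ^+ 2 * p.
    by rewrite /q; field.
  have : 0 <= (t * k / 2) ^+ 2 * p by rewrite mulr_ge0 // sqr_ge0.
  lra.
have [S [MS S1 S2 S3]] := geometric_series hH hM MX MA q0 q1 XA Xq.
pose P := t%:C *: S; have PE x : P x = t%:C *: S x by [].
have MP : M P by exact: (M_scale hM).
have lS := M_linear hM MS; have lP := M_linear hM MP.
have AP x : A (P x) = A x.
  by rewrite PE (linZ lA); apply: (eq_of_add_sub (u := S x)); rewrite -XE; exact: S1.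
have PA x : P (A x) = A x.
  rewrite PE -(linZ lS); apply: (eq_of_add_sub (u := S x)).
  by rewrite -(linB lS) -XE; exact: S2.
pose C := (t / (1 - q)) ^+ 2.
have q1' : 0 < 1 - q by lra.
have C0 : 0 < C by rewrite exprn_gt0 // divr_gt0.
have PC x : rip (P x) (P x) <= C * rip (A x) (A x).
  rewrite PE !ripE mulrA -expr2 /C expr_div_n -[leRHS]mulrA ler_pM2l ?exprn_gt0 //.
  rewrite ler_pdivlMl ?exprn_gt0 // -!(sqr_norm hH) -exprMn.
  by rewrite ler_pXn2r ?nnegrE ?mulr_ge0 ?Re_norm_ge0 // ltW.
have P_ker x : A x = 0 -> P x = 0.
  move=> Ax; apply: (rip_eq0 (dot := dot)); apply: le_anti.
  by rewrite rip_ge0 andbT; have := PC x; rewrite Ax rip0l mulr0.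
have PP x : P (P x) = P x.
  by apply/eqP; rewrite -subr_eq0 -linB // P_ker // linB // AP subrr.
have [P' MP' PP'] := vna_adjoint hM MP.
have P'A : P' \o A = A.
  apply/esym/(adjoint_inj AA); have := adjoint_comp AA PP'.
  by rewrite (_ : A \o P = A) //; apply/funext.
have AP' : A \o P' = A.
  apply/esym/(adjoint_inj AA); have := adjoint_comp PP' AA.
  by rewrite (_ : P \o A = A) //; apply/funext.
have PPa x : P (P' x) = P x.
  apply/eqP; rewrite -subr_eq0 -linB // P_ker // linB //.
  by rewrite -[A (P' x)]/((A \o P') x) AP' subrr.
have PPadj : is_adjoint dot P P.
  have h : P = P \o P' by apply/funext => x; rewrite /= PPa.
  by rewrite {1 2}h; apply: adjoint_comp => //; exact: adjoint_sym.
clearbody P; pose Q := idfun - P.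
have QE x : Q x = x - P x by [].
have MQ : M Q by apply: (M_sub hM) => //; exact: (vna_id hM).
pose D := A + Q.
have DE x : D x = A x + (x - P x) by [].
have MD : M D by exact: (M_add hM).
have DD : is_adjoint dot D D.
  apply: adjoint_add => //; move=> x y.
  by rewrite !QE dotDl dotDr dotNl dotNr PPadj.
have PD x : P (D x) = A x by rewrite DE linD // linB // PP PA subrr addr0.
have DP x : D (P x) = A x by rewrite DE PP AP subrr addr0.
clearbody Q D.
have [e e0 De] : exists2 e, 0 < e & forall x, e * rip x x <= rip (D x) (D x).
  exists (C + 1)^-1 => [|x]; first by rewrite invr_gt0; lra.
  have AQ : rip (A x) (Q x) = 0.
    by rewrite QE !ripE -(rip_adjoint PPadj) PA subrr.
  have PQ : rip (P x) (Q x) = 0.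
    by rewrite QE !ripE -(rip_adjoint PPadj) PP subrr.
  have -> : rip (D x) (D x) = rip (A x) (A x) + rip (Q x) (Q x).
    by rewrite DE -QE !ripE (ripC _ (Q x)) AQ; ring.
  have -> : rip x x = rip (P x) (P x) + rip (Q x) (Q x).
    have {1 2}-> : x = P x + Q x by rewrite QE addrC subrK.
    by rewrite !ripE (ripC _ (Q x)) PQ; ring.
  rewrite ler_pdivrMl; last by lra.
  have := PC x; have := rip_ge0 dot (A x).
  have : 0 <= C * rip (Q x) (Q x) by rewrite mulr_ge0 ?rip_ge0 // ltW.
  lra.
have [B [MB DB BD]] := normal_invertible hH hM MD MD DD (fun x => erefl _) e0 De.
have lB := M_linear hM MB.
have PB x : P (B x) = B (P x) by rewrite -{2}(DB x) PD -DP BD.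
exists P, B; split=> //.
- by move=> x; rewrite -PD DB.
- by move=> x; rewrite -DP BD.
Qed.

End RangeProjection.

(** * Operators preserving the kernel of A *)

Section ABounded.
Context {R : realType} {H : completeNormedModType R[i]}.
Context (dot : {dot H for Num.conj}) (hH : is_hilbert dot).
Context (M : set (H -> H)) (hM : von_neumann_algebra dot M).
Context (A P B : H -> H) (MA : M A) (AA : is_adjoint dot A A).
Context (A_neq0 : A <> 0) (A_ge0 : forall x, 0 <= real_inner dot (A x) x).
Context (AP : range_inverse dot M A P B).
Implicit Types (x y z : H) (a : R[i]) (r : R) (S T X Y Z : H -> H).

Local Notation rip := (real_inner dot).

Let lA := M_linear hM MA.

(** As the kernel of [A] is the range of [1 - P], this says that [T] maps the
    kernel of [A] into itself. *)
Definition preserves_ker T := forall x, A (T (P x)) = A (T x).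

(** If [A S = T^* A] then [A T = S^* A] kills the kernel of [A]. Conversely
    [B T^* A] is an [A]-adjoint of [T]. *)
Lemma adjointable_preserves_ker T :
  A_adjointable dot M A T <-> M T /\ preserves_ker T.
Proof.
split=> [[MT [S [T' [MS TT' AS]]]]|[MT kT]].
  split=> // x; have [S' MS' SS'] := vna_adjoint hM MS.
  have AT : S' \o A = A \o T.
    have := adjoint_comp AA SS'; rewrite AS => /adjoint_inj; apply.
    exact: adjoint_comp (adjoint_sym TT') AA.
  by rewrite -[LHS]/((A \o T) (P x)) -AT /= (ri_AP AP) -[LHS]/((S' \o A) x) AT.
split=> //; have [T' MT' TT'] := vna_adjoint hM MT.
exists (B \o T' \o A), T'; split=> //.
  by apply: (vna_comp hM) => //; apply: (vna_comp hM) => //; exact: ri_MB AP.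
apply/funext => x; rewrite /= (ri_AB AP).
have ATP : (A \o T) \o P = A \o T by apply/funext => y; exact: kT.
have AT := adjoint_comp AA TT'.
have := adjoint_comp AT (ri_adj AP); rewrite ATP => /(adjoint_inj AT).
by move=> /(congr1 (@^~ x)).
Qed.

Lemma A_eq0 x : rip (A x) x = 0 -> A x = 0.
Proof.
move=> Ax; have [K _ AK] := positive_sqr_le hH hM MA AA A_ge0.
apply: (rip_eq0 (dot := dot)); apply: le_anti; rewrite rip_ge0 andbT.
by have := AK x; rewrite Ax mulr0.
Qed.

Lemma exists_norm_A1 : exists h, rip (A h) h = 1.
Proof.
have /existsNP[x Ax] : ~ forall x, A x = 0 by move=> h; apply: A_neq0; exact/funext.
have p0 : 0 < rip (A x) x.
  by rewrite lt_neqAle A_ge0 andbT; apply/eqP => /esym/A_eq0.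
exists ((Num.sqrt (rip (A x) x))^-1%:C *: x).
rewrite (linZ lA) !ripE mulrA -expr2 exprVn sqr_sqrtr ?ltW // mulVf //.
by rewrite gt_eqF.
Qed.

(** If [g] is in the kernel of [A] and [h] has [A]-norm [1], so do all the
    [h + t g], and [T] can only be bounded on this line if [T g] has [A]-norm
    [0]. For the converse, [A T h] depends only on [P h = B A h], whose norm is
    controlled by the [A]-norm of [h]. *)
Lemma A_bounded_preserves_ker T :
  A_bounded dot M A T <-> M T /\ preserves_ker T.
Proof.
split=> -[MT].
  move=> T_fin; split=> // x.
  have lT := M_linear hM MT.
  have [L TL] : exists L : R, forall h, rip (A h) h = 1 ->
      rip (A (T h)) (T h) <= L ^+ 2.
    have ub h : rip (A h) h = 1 ->
        ((Num.sqrt (rip (A (T h)) (T h)))%:E <= op_norm_A dot A T)%E.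
      move=> h1; apply: ereal_sup_ubound; exists h => //=.
      by rewrite /norm_A -/(rip _ _) h1 sqrtr1.
    move: T_fin ub; case: (op_norm_A dot A T) => [L _ ub|//|_ ub].
      exists L => h /ub; rewrite lee_fin => hL.
      rewrite -[leLHS]sqr_sqrtr // ler_pXn2r ?nnegrE ?sqrtr_ge0 //.
      by apply: le_trans hL; rewrite sqrtr_ge0.
    have [h /ub] := exists_norm_A1; by rewrite leeNy_eq.
  suff ker g : A g = 0 -> A (T g) = 0.
    apply/eqP; rewrite -subr_eq0 -(linB lA) -(linB lT); apply/eqP/ker.
    by rewrite (linB lA) (ri_AP AP) subrr.
  move=> Ag; apply: A_eq0; apply: le_anti; rewrite A_ge0 andbT leNgt; apply/negP.
  set al := rip _ _ => al0.
  have [h h1] := exists_norm_A1.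
  have gh t : rip (A (h + t%:C *: g)) (h + t%:C *: g) = 1.
    rewrite (linD lA) (linZ lA) Ag scaler0 addr0 !ripE h1.
    by rewrite (selfadjoint_rip AA h g) Ag rip0l mulr0 addr0.
  have TE t : rip (A (T (h + t%:C *: g))) (T (h + t%:C *: g)) =
      rip (A (T h)) (T h) + 2 * t * rip (A (T h)) (T g) + t ^+ 2 * al.
    rewrite (linD lT) (linZ lT) (linD lA) (linZ lA) !ripE.
    by rewrite (selfadjoint_rip AA (T g) (T h)) -/al; ring.
  (* The linear terms in [t] cancel between [t] and [- t], leaving
     [t ^ 2 al <= L ^ 2]. *)
  pose t := 1 + L ^+ 2 / al.
  have t1 : 1 <= t by rewrite lerDl divr_ge0 ?sqr_ge0 // ltW.
  have := TL _ (gh t); have := TL _ (gh (- t)); rewrite !TE.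
  have := A_ge0 (T h).
  have tal : t * al = al + L ^+ 2 by rewrite mulrDl mul1r divfK // gt_eqF.
  have : t * al <= t ^+ 2 * al.
    by rewrite ler_wpM2r ?(ltW al0) // expr2 ler_peMl //; lra.
  rewrite tal sqrrN.
  by set u := rip _ _; set v := rip _ _; set w := L ^+ 2 in tal *; lra.
move=> kT; split=> //.
have [K K0 AK] := bounded_op_bound hH (vna_bounded hM MA).
have [Kb Kb0 BK] := bounded_op_bound hH (vna_bounded hM (ri_MB AP)).
have [Kt Kt0 TK] := bounded_op_bound hH (vna_bounded hM MT).
have [N N0 AN] := positive_sqr_le hH hM MA AA A_ge0.
have AK1 := rip_op_le (ltW K0) AK.
pose L := Num.sqrt (K * (Kt ^+ 2 * (Kb ^+ 2 * N))).
apply: (@le_lt_trans _ _ L%:E); last exact: ltry.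
apply: ge_ereal_sup => _ [h /= h1 <-]; rewrite lee_fin; apply: ler_wsqrtr.
rewrite -/(rip _ _).
have {}h1 : rip (A h) h = 1.
  by rewrite -[LHS]sqr_sqrtr // -/(norm_A dot A h) h1 expr1n.
rewrite -(kT h) (selfadjoint_rip AA (T (P h))) -kT.
apply: le_trans (AK1 _) _; rewrite ler_pM2l //.
apply: le_trans (TK _) _; rewrite ler_pM2l ?exprn_gt0 // -(ri_BA AP).
apply: le_trans (BK _) _; rewrite ler_pM2l ?exprn_gt0 //.
by apply: le_trans (AN _) _; rewrite h1 mulr1.
Qed.

End ABounded.

(** * Functionals with values in the A-spectrum *)

Section Character.
Context {R : realType} {H : completeNormedModType R[i]}.
Context (dot : {dot H for Num.conj}) (hH : is_hilbert dot).
Context (M : set (H -> H)) (hM : von_neumann_algebra dot M).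
Context (A P B : H -> H) (MA : M A) (AA : is_adjoint dot A A).
Context (A_neq0 : A <> 0) (A_ge0 : forall x, 0 <= real_inner dot (A x) x).
Context (AP : range_inverse dot M A P B).
Context (phi : (H -> H) -> R[i]).
Context (phi_lin : linear_on (A_adjointable dot M A) phi).
Context (phi_spec :
  forall T, A_bounded dot M A T -> A_spectrum dot M A T (phi T)).
Implicit Types (x y z : H) (a : R[i]) (r : R) (S T X Y Z : H -> H).

Local Notation rip := (real_inner dot).

Let lA := M_linear hM MA.
Let lP := M_linear hM (ri_MP AP).
Let MP := ri_MP AP.
Let Mid := vna_id hM.

(** These operators have [P] as a reducing projection; they form a *-algebra
    containing both the identity and the corner [P M P]. *)
Definition reduced T := M T /\ forall x, T (P x) = P (T x).

Lemma preserves_ker_A_bounded T :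
  M T -> preserves_ker A P T -> A_bounded dot M A T.
Proof.
by move=> MT kT; apply/(A_bounded_preserves_ker hH hM MA AA A_neq0 A_ge0 AP).
Qed.

Lemma preserves_ker_A_adjointable T :
  M T -> preserves_ker A P T -> A_adjointable dot M A T.
Proof. by move=> MT kT; apply/(adjointable_preserves_ker hM MA AA AP). Qed.

Lemma reduced_preserves_ker T : reduced T -> preserves_ker A P T.
Proof. by move=> [_ TP] x; rewrite TP (ri_AP AP). Qed.

Lemma reduced_A_bounded T : reduced T -> A_bounded dot M A T.
Proof.
move=> rT; apply: preserves_ker_A_bounded; first by case: rT.
exact: reduced_preserves_ker.
Qed.

Lemma reduced_A_adjointable T : reduced T -> A_adjointable dot M A T.
Proof.
move=> rT; apply: preserves_ker_A_adjointable; first by case: rT.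
exact: reduced_preserves_ker.
Qed.

Lemma reduced_id : reduced idfun.
Proof. by []. Qed.

Lemma reduced_add S T : reduced S -> reduced T -> reduced (S + T).
Proof.
move=> [MS SP] [MT TP]; split; first exact: (M_add hM).
move=> x; rewrite -[LHS]/(S (P x) + T (P x)) SP TP.
by rewrite -(linD lP).
Qed.

Lemma reduced_scale a T : reduced T -> reduced (a *: T).
Proof.
move=> [MT TP]; split; first exact: (M_scale hM).
by move=> x; rewrite -[LHS]/(a *: T (P x)) TP -(linZ lP).
Qed.

Lemma reduced_sub S T : reduced S -> reduced T -> reduced (S - T).
Proof.
by move=> rS rT; rewrite -scaleN1r; apply: reduced_add => //; exact: reduced_scale.
Qed.

Lemma reduced_comp S T : reduced S -> reduced T -> reduced (S \o T).
Proof.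
move=> [MS SP] [MT TP]; split; first exact: (vna_comp hM).
by move=> x; rewrite /= TP SP.
Qed.

Lemma reduced_adjoint T : reduced T -> exists2 T', reduced T' & is_adjoint dot T T'.
Proof.
move=> [MT TP]; have [T' MT' TT'] := vna_adjoint hM MT.
exists T' => //; split=> // x.
have h1 := adjoint_comp TT' (ri_adj AP); have h2 := adjoint_comp (ri_adj AP) TT'.
have e : T \o P = P \o T by apply/funext => y; exact: TP.
rewrite e in h1; have h := adjoint_inj h2 h1.
exact: (congr1 (@^~ x) h).
Qed.

Lemma reduced_compression T : M T -> reduced (P \o T \o P).
Proof.
move=> MT; split; first by apply: (vna_comp hM) => //; exact: (vna_comp hM).
by move=> x; rewrite /= !(ri_idem AP).
Qed.

Lemma phi_add S T : reduced S -> reduced T -> phi (S + T) = phi S + phi T.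
Proof.
move=> /reduced_A_adjointable aS /reduced_A_adjointable aT.
by have := phi_lin 1 aS aT; rewrite scale1r mul1r.
Qed.

Lemma phi_scale a T : reduced T -> phi (a *: T) = a * phi T.
Proof.
move=> rT; have aT := reduced_A_adjointable rT.
have a0 : A_adjointable dot M A 0.
  by apply: reduced_A_adjointable; have := reduced_scale 0 rT; rewrite scale0r.
have phi0 : phi 0 = 0.
  have := phi_lin 1 a0 a0; rewrite scale1r mul1r addr0 => e.
  by apply: (addrI (phi 0)); rewrite -e addr0.
by have := phi_lin a aT a0; rewrite !addr0 phi0 addr0.
Qed.

Lemma phi_sub S T : reduced S -> reduced T -> phi (S - T) = phi S - phi T.
Proof.
move=> rS rT; rewrite -scaleN1r phi_add ?phi_scale ?mulN1r //.
exact: reduced_scale.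
Qed.

(** The hypothesis on [phi], with the inverse relative to [A] made explicit. *)
Lemma phi_not_invertible T W l : A_bounded dot M A T -> A_bounded dot M A W ->
  (forall x, A (l *: W x - T (W x)) = A x) ->
  (forall x, A (W (l *: x - T x)) = A x) -> phi T <> l.
Proof.
move=> bT bW TW WT e; apply: (phi_spec bT); rewrite e.
by exists W; split=> //; apply/funext => x; [exact: TW|exact: WT].
Qed.

(** For [l != 0] the scalar [l^-1] is an inverse of [l - T] relative to [A]. *)
Lemma phi_ker T : M T -> (forall x, A (T x) = 0) -> phi T = 0.
Proof.
move=> MT AT; apply: contrapT => /eqP l0.
have lT := M_linear hM MT.
apply: (@phi_not_invertible T ((phi T)^-1 *: idfun) (phi T)) => //.
- by apply: preserves_ker_A_bounded => // x; rewrite !AT.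
- exact/reduced_A_bounded/reduced_scale/reduced_id.
- move=> x; rewrite -[(_ *: _) x]/((phi T)^-1 *: x).
  by rewrite (linB lA) AT subr0 scalerA divff // scale1r.
- move=> x; rewrite -[(_ *: _) (_ - _)]/((phi T)^-1 *: (_ - _)).
  by rewrite (linZ lA) (linB lA) AT subr0 (linZ lA) scalerA mulVf // scale1r.
Qed.

Lemma phi_compression T : A_bounded dot M A T -> phi T = phi (P \o T \o P).
Proof.
move=> /(A_bounded_preserves_ker hH hM MA AA A_neq0 A_ge0 AP)[MT kT].
have rT := reduced_compression MT.
have := phi_lin (-1) (reduced_A_adjointable rT) (preserves_ker_A_adjointable MT kT).
rewrite phi_ker; first by rewrite mulN1r addrC => /esym/subr0_eq.
- by rewrite scaleN1r addrC; apply: (M_sub hM) => //; case: rT.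
- move=> x; rewrite scaleN1r -[(_ + _) x]/(- P (T (P x)) + T x).
  by rewrite addrC (linB lA) (ri_AP AP) kT subrr.
Qed.

Lemma phi_id : phi idfun = 1.
Proof.
have idE (l : R[i]) : l != 1 -> phi idfun <> l.
  rewrite -subr_eq0 => l1.
  have lE y : l *: y - y = (l - 1) *: y by rewrite scalerBl scale1r.
  apply: (@phi_not_invertible _ ((l - 1)^-1 *: idfun)).
  - exact/reduced_A_bounded/reduced_id.
  - exact/reduced_A_bounded/reduced_scale/reduced_id.
  - move=> x; rewrite -[LHS]/(A (l *: ((l - 1)^-1 *: x) - (l - 1)^-1 *: x)).
    by rewrite lE scalerA divff // scale1r.
  - move=> x; rewrite -[LHS]/(A ((l - 1)^-1 *: (l *: x - x))).
    by rewrite lE scalerA mulVf // scale1r.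
by apply/eqP; apply: contrapT => /negP/idE.
Qed.

Lemma phi_A_neq0 : phi A != 0.
Proof.
apply/eqP/(@phi_not_invertible A (-1 *: B)).
- by apply: reduced_A_bounded; split=> // x; rewrite (ri_AP AP) (ri_PA AP).
- apply/reduced_A_bounded/reduced_scale; split; first exact: ri_MB AP.
  by move=> x; rewrite (ri_PB AP).
- move=> x; rewrite scale0r sub0r -[(_ *: B) x]/(-1 *: B x) scaleN1r.
  by rewrite !(linN lA) opprK (ri_AB AP) (ri_AP AP).
- move=> x; rewrite scale0r sub0r -[(_ *: B) _]/(-1 *: B (- A x)) scaleN1r.
  by rewrite (linN (M_linear hM (ri_MB AP))) opprK (ri_BA AP) (ri_AP AP).
Qed.

(** The only way in which the spectrum enters the rest of the argument. *)
Lemma phi_normal_bounded_below Y Y' l e :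
  reduced Y -> M Y' -> is_adjoint dot Y Y' -> (forall x, Y (Y' x) = Y' (Y x)) -> 0 < e ->
  (forall x, e * rip x x <= rip (l *: x - Y x) (l *: x - Y x)) -> phi Y <> l.
Proof.
move=> rY MY' YY' YC e0 Ye.
have [MY YP] := rY; have lY := M_linear hM MY; have lY' := M_linear hM MY'.
pose L := l *: idfun - Y; pose L' := l^*%C *: idfun - Y'.
have LE x : L x = l *: x - Y x by [].
have L'E x : L' x = l^*%C *: x - Y' x by [].
have rL : reduced L by apply: reduced_sub => //; exact/reduced_scale/reduced_id.
have ML' : M L' by apply: (M_sub hM) => //; exact: (M_scale hM).
have LL' : is_adjoint dot L L'.
  move=> x y; rewrite LE L'E dotDl dotNl dotDr dotNr YY' dotZl dotZr.
  by rewrite conjcK.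
have LC x : L (L' x) = L' (L x).
  rewrite !LE !L'E !(linB lY) !(linB lY') (linZ lY) (linZ lY') !scalerBr YC.
  rewrite !scalerA (mulrC l) !opprD !opprK !addrA; congr (_ + _).
  by rewrite addrAC.
have [W [MW LW WL]] := normal_invertible hH hM (proj1 rL) ML' LL' LC e0 Ye.
have lW := M_linear hM MW.
apply: (@phi_not_invertible _ W).
- exact: reduced_A_bounded.
- apply: reduced_A_bounded; split=> // x.
  by rewrite -{1}(LW x) -(proj2 rL) WL.
- by move=> x; rewrite -LE LW.
- by move=> x; rewrite -LE WL.
Qed.

(** If [Im l != 0] then [|(l - T) x| ^ 2 >= (Im l) ^ 2 |x| ^ 2], the real and
    imaginary parts of [l - T] contributing orthogonally. *)
Lemma phi_selfadjoint T : reduced T -> is_adjoint dot T T ->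
  phi T = (complex.Re (phi T))%:C.
Proof.
move=> rT TT; set l := phi T; apply/eqP; rewrite eq_complex /= eqxx /=.
apply: contrapT => /negP l0.
have Tl : phi T = l by [].
apply: (phi_normal_bounded_below (e := complex.Im l ^+ 2) rT (proj1 rT) TT
  (fun x => erefl _) _ _ Tl).
  by rewrite lt_neqAle sqr_ge0 andbT eq_sym sqrf_eq0.
move=> x; pose u := (complex.Re l)%:C *: x - T x.
have -> : l *: x - T x = u + (complex.Im l)%:C *: ('i%C *: x).
  by rewrite addrAC scalerA -scalerDl mulrC -complexE.
have : rip u ('i%C *: x) = 0.
  rewrite !ripE (selfadjoint_rip_i TT) subr0.
  by rewrite (selfadjoint_rip_i (adjoint_id dot) x) mulr0.
clearbody u => ux; rewrite !ripE rip_i (ripC _ _ u) ux.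
have := rip_ge0 dot u; rewrite expr2; lra.
Qed.

Lemma phi_positive T : reduced T -> positive_op dot T -> 0 <= phi T.
Proof.
move=> rT pT; have TT := positive_selfadjoint (M_linear hM (proj1 rT)) pT.
have lE := phi_selfadjoint rT TT.
rewrite lE lecR leNgt; apply/negP => l0.
apply: (phi_normal_bounded_below (e := complex.Re (phi T) ^+ 2) rT (proj1 rT) TT
  (fun x => erefl _) _ _ lE).
  by rewrite -sqrrN exprn_gt0 // oppr_gt0; exact: l0.
move=> x; set l := complex.Re _ in l0 *.
rewrite !ripE (ripC _ x (T x)).
have := rip_ge0 dot (T x).
have : 0 <= rip (T x) x by have := pT x; rewrite lecE => /andP[].
move=> p0; have : 0 <= - l * rip (T x) x by rewrite mulr_ge0 // oppr_ge0 ltW.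
rewrite expr2; lra.
Qed.

(** Both [phi T = a] and [phi (T ^ 2) = b] are real, and [phi] takes the value
    [a + i b] at the normal operator [Y = T + i T ^ 2]. If [b != a ^ 2], then
    [a + i b - Y] would be bounded below, as [(a - T) x] and [(b - T ^ 2) x]
    cannot both be small. *)
Lemma phi_sqr T : reduced T -> is_adjoint dot T T -> phi (T \o T) = phi T ^+ 2.
Proof.
move=> rT TT; have [MT TP] := rT; have lT := M_linear hM MT.
have rT2 := reduced_comp rT rT.
have aE := phi_selfadjoint rT TT.
have bE := phi_selfadjoint rT2 (adjoint_comp TT TT).
set a := complex.Re _ in aE; set b := complex.Re _ in bE.
rewrite bE aE -rmorphXn; congr (_%:C); apply: contrapT => /eqP ab.
pose Y := T + 'i%C *: (T \o T); pose Y' := T - 'i%C *: (T \o T).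
have YE x : Y x = T x + 'i%C *: T (T x) by [].
have Y'E x : Y' x = T x - 'i%C *: T (T x) by [].
have riT2 := reduced_scale 'i%C rT2.
have rY : reduced Y by apply: reduced_add.
have MY' : M Y' by apply: (M_sub hM) => //; case: riT2.
have YY' : is_adjoint dot Y Y'.
  move=> x y; rewrite YE Y'E dotDl dotDr dotNr dotZl dotZr !TT.
  by rewrite conjc_i mulNr opprK.
have YC x : Y (Y' x) = Y' (Y x).
  rewrite !YE !Y'E !(linD lT, linN lT, linZ lT) !scalerDr !scalerN.
  by rewrite opprD !addrA subrK addrK.
have phiY : phi Y = a%:C + 'i%C * b%:C.
  by rewrite phi_add // phi_scale // -aE -bE.
have [K K0 TK] := bounded_op_bound hH (vna_bounded hM MT).
pose d := b - a ^+ 2; have d0 : d != 0 by rewrite subr_eq0.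
have d2 : 0 < d ^+ 2 by rewrite lt_neqAle sqr_ge0 andbT eq_sym sqrf_eq0.
pose k := 3 * (1 + a ^+ 2 + K ^+ 2).
have k0 : 0 < k.
  have := sqr_ge0 a; have := sqr_ge0 K.
  by rewrite /k; set u := _ ^+ 2; set v := _ ^+ 2; lra.
apply: (phi_normal_bounded_below (e := d ^+ 2 / k) rY MY' YY' YC _ _ phiY).
  by rewrite divr_gt0.
move=> x.
pose u := a%:C *: x - T x; pose v := b%:C *: x - T (T x).
have -> : (a%:C + 'i%C * b%:C) *: x - Y x = u + 'i%C *: v.
  rewrite YE /u /v scalerDl scalerBr scalerA opprD !addrA; congr (_ - _).
  by rewrite addrAC.
(* [<u, v>] is real, since [G F] is self-adjoint. *)
have uv : rip u ('i%C *: v) = 0.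
  pose F := a%:C *: idfun - T; pose G := b%:C *: idfun - (T \o T).
  have FE y : F y = a%:C *: y - T y by [].
  have GE y : G y = b%:C *: y - T (T y) by [].
  have FF : is_adjoint dot F F.
    by move=> y z; rewrite !FE dotDl dotDr dotNl dotNr dotZl dotZr conjc_real TT.
  have GG : is_adjoint dot G G.
    by move=> y z; rewrite !GE dotDl dotDr dotNl dotNr dotZl dotZr conjc_real !TT.
  have GF : G \o F = F \o G.
    apply/funext => y.
    rewrite -[LHS]/(b%:C *: (a%:C *: y - T y) - T (T (a%:C *: y - T y))).
    rewrite -[RHS]/(a%:C *: (b%:C *: y - T (T y)) - T (b%:C *: y - T (T y))).
    rewrite !(linD lT, linN lT, linZ lT) !scalerDr !scalerN !scalerA (mulrC a%:C).
    by rewrite !opprD !opprK !addrA; congr (_ + _); rewrite addrAC.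
  have GFa : is_adjoint dot (G \o F) (G \o F).
    by rewrite {2}GF; exact: adjoint_comp.
  have := selfadjoint_rip_i GFa x.
  have -> : (G \o F) x = G u by [].
  have -> : rip (G u) ('i%C *: x) = rip u ('i%C *: v); last by [].
  by rewrite /real_inner !dotZr GG.
(* The identity [b - a ^ 2 = (b - T ^ 2) - (a + T) (a - T)]. *)
have dx : d%:C *: x = v - a%:C *: u - T u.
  rewrite /u /v (linB lT) (linZ lT) scalerBr scalerA -rmorphM /= -expr2.
  by rewrite rmorphB scalerBl !opprB addrAC !subrKA.
clearbody u v; have uK := TK u.
have le3 (p q w : H) : rip (p + q + w) (p + q + w) <=
    3 * (rip p p + rip q q + rip w w).
  have := rip_ge0 dot (p - q); have := rip_ge0 dot (q - w).
  have := rip_ge0 dot (p - w).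
  by rewrite !ripE (ripC _ q p) (ripC _ w p) (ripC _ w q); lra.
have := le3 v (- (a%:C *: u)) (- T u).
rewrite -dx !ripNl !ripNr !opprK !ripZl !ripZr !mulrA -!expr2.
have -> : rip (u + 'i%C *: v) (u + 'i%C *: v) = rip u u + rip v v.
  rewrite ripDl !ripDr (ripC _ _ u) uv addr0 add0r; congr (_ + _).
  exact: rip_i.
move: (rip_ge0 dot u) (rip_ge0 dot v) uK.
set p := rip u u; set q := rip v v; set w := rip (T u) (T u) => p0 q0 wK dle.
rewrite mulrAC ler_pdivrMr //; apply: le_trans dle _.
have := mulr_ge0 (sqr_ge0 a) q0; have := mulr_ge0 (sqr_ge0 K) q0.
rewrite /k; nra.
Qed.

Lemma phi_adjoint T T' : reduced T -> reduced T' -> is_adjoint dot T T' ->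
  phi T' = (phi T)^*%C.
Proof.
move=> rT rT' TT'.
pose U := T + T'; pose V := 'i%C *: (T - T').
have rU : reduced U by apply: reduced_add.
have rV : reduced V by apply/reduced_scale/reduced_sub.
have UU : is_adjoint dot U U by exact: adjoint_real_part.
have VV : is_adjoint dot V V by exact: adjoint_imaginary_part.
have := phi_selfadjoint rU UU; have := phi_selfadjoint rV VV.
have -> : phi V = 'i%C * (phi T - phi T').
  by rewrite phi_scale ?phi_sub //; exact: reduced_sub.
have -> : phi U = phi T + phi T' by exact: phi_add.
case: (phi T) (phi T') => [a b] [c d] /= [] e1 [] e2.
by apply/eqP; rewrite eq_complex /=; apply/andP; split; apply/eqP; lra.
Qed.

(** The Cauchy-Schwarz inequality
    [|phi (S T)| ^ 2 <= phi (S S^* ) phi (T ^ 2)], in the case where the right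
    side vanishes. *)
Lemma phi_comp_selfadjoint0 S T : reduced S -> reduced T -> is_adjoint dot T T ->
  phi T = 0 -> phi (S \o T) = 0.
Proof.
move=> rS rT TT phiT; have [S' rS' SS'] := reduced_adjoint rS.
have lT := M_linear hM (proj1 rT); have lS := M_linear hM (proj1 rS).
set be := phi (S \o T).
have rST := reduced_comp rS rT; have rTS' := reduced_comp rT rS'.
have rSS' := reduced_comp rS rS'; have rTT := reduced_comp rT rT.
have phiTS' : phi (T \o S') = be^*%C.
  by apply: phi_adjoint => //; exact: adjoint_comp.
have phiTT : phi (T \o T) = 0 by rewrite phi_sqr // phiT expr0n.
have ka0 : 0 <= phi (S \o S').
  apply: phi_positive => // x; rewrite /= (SS' (S' x)); exact: dnorm_ge0.
set ka := phi (S \o S') in ka0.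
have kaE : ka = (complex.Re ka)%:C by apply/esym/RRe_real/ger0_real.
move: ka0; rewrite kaE lecR; set k := complex.Re ka => k0.
pose n := complex.Re be ^+ 2 + complex.Im be ^+ 2.
have be2 : be * be^*%C = n%:C by rewrite -sqr_normc -add_Re2_Im2.
have n_ge0 : 0 <= n by rewrite addr_ge0 ?sqr_ge0.
suff : n = 0.
  move=> n0; apply/eqP; rewrite -normr_eq0 -sqrf_eq0.
  by rewrite -add_Re2_Im2 -/n n0.
clearbody n.
pose t := (1 + k)^-1.
have t0 : 0 < t by rewrite invr_gt0; lra.
have tk : t * k <= 1 by rewrite mulrC ler_pdivrMr; lra.
(* [W] is [Z^* Z] for [Z = T + z S^*]; with this [z] its image under [phi] is
   [n (- 2 t + t ^ 2 k)], which is negative unless [n = 0]. *)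
pose z := - (t%:C * be).
pose W := T \o T + z *: (T \o S') + z^*%C *: (S \o T) +
  (z * z^*%C) *: (S \o S').
have rW : reduced W.
  by repeat (apply: reduced_add); try (apply: reduced_scale) => //.
have pW : positive_op dot W.
  move=> x; rewrite [dot _ _](_ : _ = dot (T x + z *: S' x) (T x + z *: S' x)).
    exact: dnorm_ge0.
  rewrite -[W x]/(T (T x) + z *: T (S' x) + z^*%C *: S (T x) +
    (z * z^*%C) *: S (S' x)).
  rewrite !dotDl !dotDr !dotZl !dotZr.
  by rewrite (TT (T x) x) (TT (S' x) x) (SS' (T x) x) (SS' (S' x) x); ring.
have := phi_positive rW pW.
rewrite /W !phi_add ?phi_scale //;
  try by repeat (apply: reduced_add); try (apply: reduced_scale).
rewrite phiTT phiTS' -/be -/ka kaE -/k /z add0r.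
rewrite conjc_oppr_scale.
have -> : - (t%:C * be) * be^*%C + - (t%:C * be^*%C) * be +
    - (t%:C * be) * - (t%:C * be^*%C) * k%:C =
    (- (t * n + t * n) + t * t * k * n)%:C.
  by rewrite !(rmorphD, rmorphN, rmorphM) /= -be2; ring.
rewrite lecR => h.
have : t * (t * k) * n <= t * 1 * n by rewrite ler_wpM2r // ler_pM2l.
have tn0 : 0 <= t * n by rewrite mulr_ge0 // ltW.
move=> h2; have : t * n = 0 by lra.
by move/eqP; rewrite mulf_eq0 gt_eqF //= => /eqP.
Qed.

Lemma phi_comp_selfadjoint S T : reduced S -> reduced T -> is_adjoint dot T T ->
  phi (S \o T) = phi S * phi T.
Proof.
move=> rS rT TT; have lS := M_linear hM (proj1 rS).
have ri := reduced_scale (phi T) reduced_id.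
have rU : reduced (T - phi T *: idfun) by apply: reduced_sub.
have phiU : phi (T - phi T *: idfun) = 0.
  by rewrite phi_sub // phi_scale // phi_id mulr1 subrr.
have UU : is_adjoint dot (T - phi T *: idfun) (T - phi T *: idfun).
  have TE := phi_selfadjoint rT TT.
  have UE x : (T - phi T *: idfun) x = T x - phi T *: x by [].
  by move=> x y; rewrite !UE dotDl dotNl dotDr dotNr dotZl dotZr TT TE conjc_real.
have := phi_comp_selfadjoint0 rS rU UU phiU.
have -> : S \o (T - phi T *: idfun) = - phi T *: S + (S \o T).
  apply/funext => x; rewrite -[LHS]/(S (T x - phi T *: x)) (linB lS) (linZ lS).
  by rewrite addrC -scaleNr.
rewrite phi_add ?phi_scale //; last 2 first.
- exact: reduced_scale.
- exact: reduced_comp.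
by rewrite mulNr addrC => /subr0_eq ->; rewrite mulrC.
Qed.

Lemma phi_comp_reduced S T : reduced S -> reduced T -> phi (S \o T) = phi S * phi T.
Proof.
move=> rS rT; have [T' rT' TT'] := reduced_adjoint rT.
have lS := M_linear hM (proj1 rS).
pose U := T + T'; pose V := 'i%C *: (T - T').
have rU : reduced U by apply: reduced_add.
have rV : reduced V by apply/reduced_scale/reduced_sub.
have UU : is_adjoint dot U U by exact: adjoint_real_part.
have VV : is_adjoint dot V V by exact: adjoint_imaginary_part.
have ii : ('i%C : R[i]) * 'i%C = -1 by rewrite -expr2 sqr_i.
have TE : T = 2^-1 *: (U + (- 'i%C) *: V).
  apply/funext => x.
  rewrite -[RHS]/(2^-1 *: (T x + T' x + (- 'i%C) *: ('i%C *: (T x - T' x)))).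
  rewrite scalerA mulNr ii opprK scale1r addrACA subrr addr0.
  rewrite scalerDr -scalerDl (_ : 2^-1 + 2^-1 = 1) ?scale1r //; by field.
have STE : S \o T = 2^-1 *: (S \o U + (- 'i%C) *: (S \o V)).
  apply/funext => x; rewrite -[LHS]/(S (T x)) {1}TE.
  rewrite -[RHS]/(2^-1 *: (S (U x) + (- 'i%C) *: S (V x))).
  rewrite -[X in S X]/(2^-1 *: (U x + (- 'i%C) *: V x)).
  by rewrite (linZ lS) (linD lS) (linZ lS).
have rSU := reduced_comp rS rU; have rSV := reduced_comp rS rV.
have riV := reduced_scale (- 'i%C) rV; have riSV := reduced_scale (- 'i%C) rSV.
have -> : phi T = 2^-1 * (phi U + - 'i%C * phi V).
  rewrite {1}TE phi_scale; last exact: reduced_add.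
  by rewrite phi_add // phi_scale.
rewrite STE phi_scale; last exact: reduced_add.
rewrite phi_add // phi_scale // (phi_comp_selfadjoint rS rU UU).
by rewrite (phi_comp_selfadjoint rS rV VV); ring.
Qed.

(** [P S T P = (P S P) (P T P)] because [P S = P S P]. *)
Lemma phi_comp S T : A_bounded dot M A S -> A_bounded dot M A T ->
  phi (S \o T) = phi S * phi T.
Proof.
have bP := A_bounded_preserves_ker hH hM MA AA A_neq0 A_ge0 AP.
move=> bS bT; have [MS kS] := (bP S).1 bS; have [MT kT] := (bP T).1 bT.
have PkT T0 : preserves_ker A P T0 -> forall x, P (T0 (P x)) = P (T0 x).
  by move=> k x; rewrite -(ri_BA AP (T0 (P x))) -(ri_BA AP (T0 x)) k.
have bST : A_bounded dot M A (S \o T).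
  apply: preserves_ker_A_bounded; first exact: (vna_comp hM).
  by move=> x; rewrite /= -kS PkT // kS.
rewrite (phi_compression bST) (phi_compression bS) (phi_compression bT).
rewrite -phi_comp_reduced; try exact: reduced_compression.
congr (phi _); apply/funext => x.
by rewrite /= (ri_idem AP) (PkT S kS).
Qed.

(** A multiplicative positive functional is contractive: if [|Y| <= 1] then
    [1 - Y^* Y >= 0], so that [|phi Y| ^ 2 = phi (Y^* Y) <= 1]. *)
Lemma phi_compression_state : state dot M (fun T => phi (P \o T \o P)).
Proof.
have fid : phi (P \o idfun \o P) = 1.
  by rewrite -phi_compression ?phi_id //; exact/reduced_A_bounded/reduced_id.
split=> //.
- move=> a T S MT MS.
  rewrite -phi_scale -?phi_add; try exact: reduced_compression; last first.
    exact/reduced_scale/reduced_compression.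
  congr (phi _); apply/funext => x.
  rewrite -[LHS]/(P (a *: T (P x) + S (P x))) (linD lP) (linZ lP).
  by [].
- move=> T MT pT; apply: phi_positive; first exact: reduced_compression.
  by move=> x; rewrite /= (ri_adj AP); exact: pT.
apply: le_anti; apply/andP; split.
  apply: ge_ereal_sup => _ [T [MT T1] <-]; rewrite lee_fin.
  have lT := M_linear hM MT.
  have contr y : rip (T y) (T y) <= rip y y.
    exact: op_norm_contraction.
  have Pcontr y : rip (P y) (P y) <= rip y y.
    have := rip_ge0 dot (y - P y).
    rewrite !ripE (ripC _ y (P y)) -{1 2}(ri_idem AP y).
    rewrite (rip_adjoint (ri_adj AP)); lra.
  set Y := P \o T \o P.
  have rY : reduced Y by exact: reduced_compression.
  have [Y' rY' YY'] := reduced_adjoint rY.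
  have rYY := reduced_comp rY' rY.
  have pos : 0 <= phi (idfun - (Y' \o Y)).
    apply: phi_positive; first by apply: reduced_sub.
    move=> x; rewrite [(idfun - _) x](_ : _ = x - Y' (Y x)) // dotDl dotNl.
    rewrite (adjoint_sym YY').
    rewrite !dot_rip -rmorphB lecR subr_ge0.
    by apply: le_trans (Pcontr _) _; apply: le_trans (contr _) _; exact: Pcontr.
  move: pos; rewrite phi_sub // phi_id.
  rewrite (phi_comp_reduced rY' rY) (phi_adjoint rY rY' YY') subr_ge0.
  rewrite mulrC -sqr_normc => h.
  rewrite -lecR; have -> : (complex.Re `|phi Y|)%:C = `|phi Y|.
    exact/RRe_real/normr_real.
  by rewrite -(ler_pXn2r (n := 2)) ?nnegrE // expr1n.
apply: ereal_sup_ubound; exists idfun; last by rewrite fid normr1.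
split=> //; apply: ge_ereal_sup => _ [h /= h1 <-].
by rewrite lee_fin -lecR -normE.
Qed.

End Character.

Theorem corollary3p8 (R : realType) (H : completeNormedModType R[i])
    (dot : {dot H for Num.conj}) (hH : is_hilbert dot)
    (M : set (H -> H)) (hM : von_neumann_algebra dot M)
    (A : H -> H) (MA : M A) (A_neq0 : A <> 0) (A_pos : positive_op dot A)
    (phi : (H -> H) -> R[i]) (phi_lin : linear_on (A_adjointable dot M A) phi)
    (A_ws : well_supported M A)
    (phi_spec : forall T, A_bounded dot M A T -> A_spectrum dot M A T (phi T)) :
  exists f : (H -> H) -> R[i],
    [/\ state dot M f,
        (forall T, A_adjointable dot M A T -> phi T = f T),
        phi A != 0
      & forall T S, A_bounded dot M A T -> A_bounded dot M A S ->
          phi (T \o S) = phi T * phi S].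
Proof.
have AA := positive_selfadjoint (M_linear hM MA) A_pos.
have A_ge0 x : 0 <= real_inner dot (A x) x.
  by have := A_pos x; rewrite lecE => /andP[].
have [P [B AP]] := range_projection hH hM MA AA A_ge0 A_ws.
exists (fun T => phi (P \o T \o P)); split.
- exact: (phi_compression_state hH hM MA AA A_neq0 A_ge0 AP phi_lin phi_spec).
- move=> T /(adjointable_preserves_ker hM MA AA AP).
  move=> /(A_bounded_preserves_ker hH hM MA AA A_neq0 A_ge0 AP).
  exact: (phi_compression hH hM MA AA A_neq0 A_ge0 AP phi_lin phi_spec).
- exact: (phi_A_neq0 hH hM MA AA A_neq0 A_ge0 AP phi_spec).
- exact: (phi_comp hH hM MA AA A_neq0 A_ge0 AP phi_lin phi_spec).
Qed.
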